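(* Let $\{D_\lambda\}_{\lambda\in\mathbb{N}}$ be a family of distributions over pairs $(x,y)$ of classical bit strings, and suppose there exist families of distributions $\{E_\lambda\}_{\lambda}$ (over strings $x$) and $\{F_\lambda\}_{\lambda}$ (over strings $y$) such that $\|D_\lambda-E_\lambda\times F_\lambda\|_1<\frac{5-2\sqrt2}{17}$, i.e., $\sum_{x,y}|\Pr_{D_\lambda}[(x,y)]-\Pr_{E_\lambda}[x]\Pr_{F_\lambda}[y]|<\frac{5-2\sqrt2}{17}$. Then there is no (non-interactive) commitment scheme in the correlated randomness model with $\{D_\lambda\}$ that is simultaneously statistically hiding and statistically (sum-)binding.
   Context: A (non-interactive) commitment scheme in the correlated randomness model with $\{D_\lambda\}$ consists of uniform QPT algorithms $\mathsf{Setup}$, $C$, $R$. Setup: $\mathsf{Setup}(1^\lambda)$ samples $(x,y)\gets D_\lambda$, sends $x$ to $C$ and $y$ to $R$. Commit: $C$ on input $x$ and a bit $b$ generates a quantum state $\ket{\Psi_{x,b}}$ on registers $\mathbf{C},\mathbf{R}$ and sends $\mathbf{C}$ to $R$. Reveal: $C$ sends $b$ and $\mathbf{R}$; $R$ applies a POVM $\{\Lambda_{y,b},I-\Lambda_{y,b}\}$ to $(\mathbf{C},\mathbf{R})$ and outputs $b$ on outcome $\Lambda_{y,b}$, else $\bot$. Correctness: honest runs are accepted with probability 1. Statistical hiding: every unbounded adversary given $y$ and register $\mathbf{C}$ of an honest commitment distinguishes $b=0$ from $b=1$ with advantage $\mathsf{negl}(\lambda)$. Statistical sum-binding: for any pair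 of unbounded malicious committers $C_0^*,C_1^*$ that receive $x$ and act identically in the commit phase, letting $p_b$ be the probability that $R$ accepts the revealed bit $b$ from $C_b^*$, $p_0+p_1\le1+\mathsf{negl}(\lambda)$. *)

(* Defs.v *)
From HB Require Import structures.
From mathcomp Require Import all_boot all_order all_algebra.
From mathcomp Require Import classical_sets reals ereal esum.
From mathcomp.real_closed Require Import complex.

Set Implicit Arguments.
Unset Strict Implicit.
Unset Printing Implicit Defensive.
Import Order.TTheory GRing.Theory Num.Theory.
Local Open Scope ring_scope.

Section Quantum.
Variable R : realType.
Local Notation C := (R[i]).

Definition braket (I : finType) (u v : I -> C) : C :=
  \sum_(i : I) (conjc (u i)) * v i.

Definition apply_op (I : finType) (A : I -> I -> C) (v : I -> C) : I -> C :=
  fun i => \sum_(j : I) A i j * v j.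

Definition expect (I : finType) (A : I -> I -> C) (v : I -> C) : C :=
  braket v (apply_op A v).

Definition idop (I : finType) : I -> I -> C :=
  fun i j => if i == j then 1 else 0.

Definition adjoint (I : finType) (A : I -> I -> C) : I -> I -> C :=
  fun i j => conjc (A j i).

Definition compose (I : finType) (A B : I -> I -> C) : I -> I -> C :=
  fun i k => \sum_(j : I) A i j * B j k.

Definition tensor (I J : finType) (A : I -> I -> C) (B : J -> J -> C)
  : (I * J) -> (I * J) -> C :=
  fun p q => A p.1 q.1 * B p.2 q.2.

Definition psd (I : finType) (A : I -> I -> C) : Prop :=
  forall v : I -> C, 0 <= expect A v.

Definition povm_elem (I : finType) (A : I -> I -> C) : Prop :=
  psd A /\ psd (fun i j => @idop I i j - A i j).

Definition unit_vector (I : finType) (v : I -> C) : Prop := braket v v = 1.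

Definition unitary (I : finType) (U : I -> I -> C) : Prop :=
  compose (adjoint U) U = @idop I.

Definition prob_op (I : finType) (A : I -> I -> C) (v : I -> C) : R :=
  complex.Re (expect A v).

End Quantum.
Arguments idop {R} I.

Section Distr.
Variable R : realType.
Local Open Scope ereal_scope.

Definition is_distr (T : choiceType) (p : T -> R) : Prop :=
  (forall t, (0 <= p t)%R) /\ \esum_(t in [set: T]) (p t)%:E = 1.

(* E_{t ~ p}[f t] as an extended real (f is nonnegative in all uses) *)
Definition eexpect (T : choiceType) (p : T -> R) (f : T -> R) : \bar R :=
  \esum_(t in [set: T]) (p t * f t)%:E.

Definition expectation (T : choiceType) (p : T -> R) (f : T -> R) : R :=
  fine (eexpect p f).

Definition l1_dist_prod (T U : choiceType) (D : T * U -> R) (E : T -> R)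
  (F : U -> R) : \bar R :=
  \esum_(xy in [set: T * U]) (`| D xy - E xy.1 * F xy.2 |)%:E.

End Distr.

Definition negligible (R : realType) (f : nat -> R) : Prop :=
  forall c : nat, exists N : nat, forall n : nat, (N <= n)%N ->
    `|f n| * (n%:R ^+ c) < 1.

(* Non-interactive commitment scheme in the correlated randomness     *)
(* model.  Security parameter n (= lambda).  Strings are seq bool.    *)
(* Registers C and R have dimensions dimC n, dimR n.                  *)
(*  Psi n x b : the honest commitment state |Psi_{x,b}> on (C,R)      *)
(*  Lam n y b : the receiver's POVM element Lambda_{y,b} on (C,R)     *)
Record scheme (R : realType) := Scheme {
  dimC : nat -> nat;
  dimR : nat -> nat;
  Psi : forall n : nat, seq bool -> bool -> ('I_(dimC n) * 'I_(dimR n)) -> R[i];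
  Lam : forall n : nat, seq bool -> bool ->
          ('I_(dimC n) * 'I_(dimR n)) -> ('I_(dimC n) * 'I_(dimR n)) -> R[i]
}.

Arguments dimC {R} s n.
Arguments dimR {R} s n.
Arguments Psi {R} s n.
Arguments Lam {R} s n.

Section SchemeProps.
Variable R : realType.
Variable D : nat -> seq bool * seq bool -> R.
Variable S : scheme R.

Definition well_formed : Prop :=
  (forall n x b, unit_vector (Psi S n x b)) /\
  (forall n y b, povm_elem (Lam S n y b)).

Definition correct : Prop :=
  forall n (b : bool),
    eexpect (D n) (fun xy => prob_op (Lam S n xy.2 b) (Psi S n xy.1 b)) = 1%E.

(* probability that the (unbounded) hiding adversary, described by the
   POVM element M n y on register C (outcome "1"), outputs 1 when the
   committed bit is b *)
Definition hiding_out (M : forall n : nat, seq bool -> 'I_(dimC S n) -> 'I_(dimC S n) -> R[i])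
  (n : nat) (b : bool) : R :=
  expectation (D n)
    (fun xy => prob_op (tensor (M n xy.2) (idop 'I_(dimR S n))) (Psi S n xy.1 b)).

Definition stat_hiding : Prop :=
  forall M : forall n : nat, seq bool -> 'I_(dimC S n) -> 'I_(dimC S n) -> R[i],
    (forall n y, povm_elem (M n y)) ->
    negligible (fun n => hiding_out M n false - hiding_out M n true).

(* Malicious committers C_0^*, C_1^*: identical commit phase producing the
   pure state phi n x on C (x) (R (x) J) (J = private workspace of
   dimension dimJ n); in the reveal phase C_b^* applies the unitary
   U n b x on (R (x) J) and sends R.  The receiver measures Lam n y b on
   (C,R). *)
Definition lam_ext (dimJ : nat -> nat) (n : nat) (y : seq bool) (b : bool)
  : ('I_(dimC S n) * ('I_(dimR S n) * 'I_(dimJ n))) ->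
    ('I_(dimC S n) * ('I_(dimR S n) * 'I_(dimJ n))) -> R[i] :=
  fun p q => Lam S n y b (p.1, p.2.1) (q.1, q.2.1) * idop 'I_(dimJ n) p.2.2 q.2.2.

Definition binding_acc (dimJ : nat -> nat)
  (phi : forall n : nat, seq bool -> ('I_(dimC S n) * ('I_(dimR S n) * 'I_(dimJ n))) -> R[i])
  (U : forall n : nat, bool -> seq bool ->
        ('I_(dimR S n) * 'I_(dimJ n)) -> ('I_(dimR S n) * 'I_(dimJ n)) -> R[i])
  (n : nat) (b : bool) : R :=
  expectation (D n) (fun xy =>
    prob_op (@lam_ext dimJ n xy.2 b)
      (apply_op (tensor (idop 'I_(dimC S n)) (U n b xy.1)) (phi n xy.1))).

Definition stat_sum_binding : Prop :=
  forall (dimJ : nat -> nat)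
    (phi : forall n : nat, seq bool -> ('I_(dimC S n) * ('I_(dimR S n) * 'I_(dimJ n))) -> R[i])
    (U : forall n : nat, bool -> seq bool ->
          ('I_(dimR S n) * 'I_(dimJ n)) -> ('I_(dimR S n) * 'I_(dimJ n)) -> R[i]),
    (forall n x, unit_vector (phi n x)) ->
    (forall n b x, unitary (U n b x)) ->
    exists nu : nat -> R, negligible nu /\
      forall n, binding_acc phi U n false + binding_acc phi U n true <= 1 + nu n.

End SchemeProps.

(* Main.v *)
Require Import Defs.
From HB Require Import structures.
From mathcomp Require Import all_boot all_order all_algebra.
From mathcomp Require Import finmap.
From mathcomp Require Import boolp classical_sets cardinality fsbigop.
From mathcomp Require Import reals ereal esum.
From mathcomp.real_closed Require Import complex.
From mathcomp Require Import spectral sesquilinear.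
From mathcomp Require Import ring lra.
Import Order.TTheory GRing.Theory Num.Theory.
Set Implicit Arguments.
Unset Strict Implicit.
Unset Printing Implicit Defensive.
Local Open Scope ring_scope.
Local Open Scope sesquilinear_scope.

(** The malicious committer ignores [x].  It prepares the purification
    [A_0 = sum_x' sqrt (p x') |x'> |Psi_(x',0)>], where [p] is (a finite
    truncation of) the marginal of [D] on [x], and sends [C].  Opening to 0 is
    honest for the fresh sample [x']; since [D] is within [eps] of a product, it
    is within [3 eps] of the product of its own marginals, so by correctness the
    receiver accepts with probability at least [1 - 3 eps].  For the bit 1, let
    [rho_b] be the mean reduced state on [C].  Hiding, against a receiver that
    ignores [y], makes every measurement nearly blind to [rho_0 - rho_1].
    Measuring the sign of [sqrt rho_0 - sqrt rho_1], the Powers-Stormer argument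
    gives [|sqrt rho_0 - sqrt rho_1|_2^2 <= 2 tr (M (rho_0 - rho_1))], and the
    polar decompositions [A_b = sqrt rho_b V_b] yield a unitary on the
    committer's side moving [A_0] to within this distance of [A_1].  Hence
    [p_0 + p_1] is close to at least [2 - 6 eps], which exceeds 1 as soon as
    [eps < 1/6]; the hypothesis gives [eps < 13/100]. *)

(** * Matrices: polar decomposition and the Powers-Stormer inequality *)

Section Adjoint.
Variable C : numClosedFieldType.

Lemma adjmxM m n p (A : 'M[C]_(m, n)) (B : 'M[C]_(n, p)) :
  (A *m B)^t* = B^t* *m A^t*.
Proof. by rewrite trmx_mul map_mxM. Qed.

Lemma adjmxB m n (A B : 'M[C]_(m, n)) : (A - B)^t* = A^t* - B^t*.
Proof. by rewrite linearB /= map_mxB. Qed.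

Lemma adjmx1 n : (1%:M : 'M[C]_n)^t* = 1%:M.
Proof. by rewrite trmx1 map_mx1. Qed.

Lemma adjmx_diag n (d : 'rV[C]_n) :
  (forall i, d 0 i \is Num.real) -> (diag_mx d)^t* = diag_mx d.
Proof.
move=> dr; apply/matrixP => i j; rewrite !mxE rmorphMn /= conj_Creal //.
by rewrite eq_sym; case: eqVneq => [->|].
Qed.

Lemma gram_diag_ge0 m n (A : 'M[C]_(m, n)) i : 0 <= (A *m A^t*) i i.
Proof. by rewrite mxE sumr_ge0 // => j _; rewrite !mxE mul_conjC_ge0. Qed.

Lemma gram_eq0 m n (A : 'M[C]_(m, n)) : A *m A^t* = 0 -> A = 0.
Proof.
move=> A0; apply/matrixP => i j; rewrite !mxE; apply/eqP.
have /matrixP/(_ i i) := A0; rewrite !mxE => /eqP.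
rewrite psumr_eq0 => [|k _]; last by rewrite !mxE mul_conjC_ge0.
by move=> /allP/(_ j); rewrite mem_index_enum !mxE mul_conjC_eq0 => /(_ isT).
Qed.

Lemma hermitian_spectral n (A : 'M[C]_n) : A^t* = A ->
  exists (Q : 'M[C]_n) (d : 'rV[C]_n), [/\ Q *m Q^t* = 1%:M, Q^t* *m Q = 1%:M,
    A = Q^t* *m diag_mx d *m Q & forall i, d 0 i \is Num.real].
Proof.
move=> Ah.
have Aherm : A \is hermsymmx.
  by apply/is_hermitianmxP; rewrite expr0 scale1r Ah.
have /unitarymxP QQ := spectral_unitarymx A.
exists (spectralmx A), (spectral_diag A); split => //.
- exact: mulmx1C.
- have /orthomx_spectralP {1}-> := hermitian_normalmx Aherm.
  by rewrite invmx_unitary // spectral_unitarymx.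
- by move=> i; apply/(mxOverP (hermitian_spectral_diag_real Aherm)).
Qed.

(* [P] is the square root of the Gram matrix of [A], [V] the pseudo-inverse of
   [P] times [A], and [E] the projection onto the kernel of [P], which makes up
   for the rows lost by [V] when [A] does not have full rank. *)
Lemma polar_padded n m (A : 'M[C]_(n, m)) :
  exists (B P : 'M[C]_n) (V : 'M[C]_(n, m)) (E : 'M[C]_n),
    [/\ P = B *m B^t*, A = P *m V, V *m V^t* + E *m E^t* = 1%:M
      & P *m E = 0].
Proof.
have [|Q [d [QQ1 QQ2 Hd dr]]] := @hermitian_spectral _ (A *m A^t*).
  by rewrite adjmxM trmxCK.
(* The eigenvalue matrix is the Gram matrix of [Q *m A], hence the eigenvalues are nonnegative. *)
have dE : diag_mx d = Q *m A *m (Q *m A)^t*.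
  rewrite adjmxM !mulmxA -(mulmxA Q A) Hd !mulmxA QQ1 mul1mx.
  by rewrite -mulmxA QQ1 mulmx1.
have d_ge0 i : 0 <= d 0 i.
  have := gram_diag_ge0 (Q *m A) i.
  by rewrite -dE mxE eqxx.
pose s i := sqrtC (d 0 i).
have s_ge0 i : 0 <= s i by rewrite sqrtC_ge0.
have ss i : s i * s i = d 0 i by rewrite -expr2 sqrtCK.
(* Functional calculus in the eigenbasis [Q]: matrix identities reduce to pointwise identities
   between eigenvalues. *)
pose f (g : 'I_n -> C) := Q^t* *m diag_mx (\row_i g i) *m Q.
have fM g h : f g *m f h = f (fun i => g i * h i).
  rewrite /f !mulmxA -(mulmxA _ Q) QQ1 mulmx1 -(mulmxA (Q^t*)) mulmx_diag.
  by congr (_ *m diag_mx _ *m _); apply/rowP => i; rewrite !mxE.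
have eqf g h : g =1 h -> f g = f h.
  move=> gh; rewrite /f; congr (_ *m diag_mx _ *m _).
  by apply/rowP => i; rewrite !mxE.
have fadj g : (forall i, g i \is Num.real) -> (f g)^t* = f g.
  move=> gr; rewrite /f !adjmxM trmxCK mulmxA adjmx_diag // => i.
  by rewrite mxE.
have fd : A *m A^t* = f (fun i => d 0 i).
  by rewrite Hd /f; congr (_ *m diag_mx _ *m _); apply/rowP => i; rewrite !mxE.
have f1 : f (fun=> 1) = 1%:M.
  rewrite /f (_ : diag_mx _ = 1%:M) ?mulmx1 //.
  by apply/matrixP => i j; rewrite !mxE.
have fB g h : f g - f h = f (fun i => g i - h i).
  rewrite /f -mulmxBl -mulmxBr -linearB; congr (_ *m diag_mx _ *m _).
  by apply/rowP => i; rewrite !mxE.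
have f0 g : g =1 (fun=> 0) -> f g = 0.
  move=> g0; rewrite (eqf _ _ g0) /f (_ : diag_mx _ = 0) ?mulmx0 ?mul0mx //.
  by apply/matrixP => i j; rewrite !mxE mul0rn.
clearbody f.
have real_ge0 (x : C) : 0 <= x -> x \is Num.real by move=> x0; rewrite realE x0.
pose e i : C := (d 0 i == 0)%:R.
have er i : e i \is Num.real by rewrite /e realn.
have Eadj : (f e)^t* = f e by apply: fadj.
(* [B] takes fourth roots of the eigenvalues [d]. Since [0^-1 = 0], inverting [s] pointwise yields
   the pseudo-inverse of [P]. *)
exists (f (fun i => sqrtC (s i))), (f s), (f (fun i => (s i)^-1) *m A), (f e).
have d0 i : d 0 i == 0 -> s i = 0 by rewrite /s => /eqP ->; rewrite sqrtC0.
have sn0 i : d 0 i != 0 -> s i != 0 by rewrite /s sqrtC_eq0.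
(* The Gram matrix of [f e *m A] has eigenvalues [e * d * e], all zero. *)
have EA : f e *m A = 0.
  apply: gram_eq0; rewrite adjmxM Eadj mulmxA -(mulmxA (f e)) fd !fM.
  by apply: f0 => i; rewrite /e; case: eqP => [->|_]; rewrite ?mulr0 ?mul0r.
split.
- rewrite fadj ?fM; last by move=> i; rewrite real_ge0 // sqrtC_ge0.
  by apply: eqf => i; rewrite -expr2 sqrtCK.
- rewrite mulmxA fM (eqf _ (fun i => 1 - e i)); last first.
    move=> i; rewrite /e; case: (boolP (d 0 i == 0)) => [/d0 ->|/sn0 /divff ->].
      by rewrite mul0r subrr.
    by rewrite subr0.
  by rewrite -(fB (fun=> 1)) f1 mulmxBl EA mul1mx subr0.
- rewrite Eadj adjmxM fadj => [|i]; last by rewrite real_ge0 // invr_ge0.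
  rewrite !mulmxA -(mulmxA _ A) fd !fM -f1.
  apply/eqP; rewrite eq_sym -subr_eq; apply/eqP; rewrite (fB (fun=> 1)).
  apply: eqf => i.
  rewrite /e; case: (boolP (d 0 i == 0)) => [/eqP ->|h].
    by rewrite mulr0 mul0r mulr1 subrr.
  by rewrite mulr0 subr0 -ss mulrA mulVf ?sn0 // mul1r divff ?sn0.
- rewrite fM; apply: f0 => i; rewrite /e.
  by case: (boolP (d 0 i == 0)) => [/d0 ->|_]; rewrite ?mul0r ?mulr0.
Qed.

(** In an eigenbasis of [S = P0 - P1], the matrix [P0^2 - P1^2 = P1 S + S P1 + S^2] has diagonal
    entries [2 s p + s^2], where [p] and [p + s] are diagonal entries of [P1] and [P0], hence
    nonnegative. Each entry thus has the sign of [s] and modulus at least [s^2]; the right-hand side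
    adds up these moduli. *)
Lemma powers_stormer n (P0 P1 B0 B1 : 'M[C]_n) :
  P0 = B0 *m B0^t* -> P1 = B1 *m B1^t* ->
  exists M : 'M[C]_n, [/\ M *m M = M, M^t* = M &
    \tr ((P0 - P1) *m (P0 - P1)) <=
      2 * \tr (M *m (P0 *m P0 - P1 *m P1)) - \tr (P0 *m P0 - P1 *m P1)].
Proof.
move=> P0E P1E.
have gh (B : 'M[C]_n) : (B *m B^t*)^t* = B *m B^t* by rewrite adjmxM trmxCK.
have [|Q [s [QQ1 QQ2 Ss sr]]] := @hermitian_spectral _ (P0 - P1).
  by rewrite adjmxB P0E P1E !gh.
pose b : 'rV[C]_n := \row_i ((0 : C) <= s 0 i)%R%:R.
have bM : diag_mx b *m diag_mx b = diag_mx b.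
  rewrite mulmx_diag; congr diag_mx; apply/rowP => i; rewrite !mxE.
  by case: (0 <= _); rewrite ?mulr0 ?mulr1.
(* The projection onto the nonnegative eigenspaces of [P0 - P1]. *)
exists (Q^t* *m diag_mx b *m Q); split.
- by rewrite !mulmxA -(mulmxA _ Q) QQ1 mulmx1 -(mulmxA (Q^t*)) bM.
- rewrite !adjmxM trmxCK adjmx_diag ?mulmxA // => i.
  by rewrite mxE realn.
pose P := Q *m P1 *m Q^t*.
have P1Q : P1 = Q^t* *m P *m Q.
  by rewrite /P !mulmxA QQ2 mul1mx -mulmxA QQ2 mulmx1.
have P0Q : P0 = Q^t* *m (P + diag_mx s) *m Q.
  by rewrite mulmxDr mulmxDl -P1Q -Ss addrC subrK.
have conjM (X Y : 'M[C]_n) :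
  (Q^t* *m X *m Q) *m (Q^t* *m Y *m Q) = Q^t* *m (X *m Y) *m Q.
  by rewrite !mulmxA -(mulmxA _ Q) QQ1 mulmx1.
have conjtr (X : 'M[C]_n) : \tr (Q^t* *m X *m Q) = \tr X.
  by rewrite mxtrace_mulC mulmxA QQ1 mul1mx.
have gram_ge0 (B : 'M[C]_n) i : 0 <= (Q *m (B *m B^t*) *m Q^t*) i i.
  rewrite (_ : _ *m _ = Q *m B *m (Q *m B)^t*) ?gram_diag_ge0 //.
  by rewrite adjmxM !mulmxA.
have p_ge0 i : 0 <= P i i by rewrite /P P1E gram_ge0.
have ps_ge0 i : 0 <= P i i + s 0 i.
  have := gram_ge0 B0 i; rewrite -P0E P0Q !mulmxA QQ1 mul1mx -mulmxA QQ1 mulmx1.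
  by rewrite mxE [X in _ + X]mxE eqxx.
have diffE : P0 *m P0 - P1 *m P1 =
    Q^t* *m (P *m diag_mx s + diag_mx s *m P + diag_mx s *m diag_mx s) *m Q.
  rewrite P0Q P1Q !conjM -mulmxBl -mulmxBr; congr (_ *m _ *m _).
  by rewrite mulmxDl !mulmxDr -[X in X - _]addrA [X in X - _]addrC addrK addrA.
rewrite diffE Ss !conjM !conjtr; set X := _ + _ + _.
rewrite /mxtrace mulr_sumr -sumrB; apply: ler_sum => i _.
have Xii : X i i = 2 * (s 0 i * P i i) + s 0 i ^+ 2.
  rewrite /X mulmx_diag mul_diag_mx mul_mx_diag !mxE eqxx mulr1n.
  by ring.
move: X Xii => X Xii.
rewrite mulmx_diag mul_diag_mx !mxE Xii eqxx mulr1n.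
have := p_ge0 i; have := ps_ge0 i; have := sr i.
move: (s 0 i) (P i i) => x p xr xp p0.
case: (boolP (0 <= x)) => [x0|].
  rewrite -subr_ge0 (_ : _ - _ = 2 * (x * p)); last by rewrite /=; ring.
  by rewrite !mulr_ge0.
rewrite -real_ltNge ?real0 // => x0.
rewrite -subr_ge0 (_ : _ - _ = 2 * (- x * (p + x))); last by rewrite /=; ring.
by rewrite !mulr_ge0 // oppr_ge0 ltW.
Qed.

End Adjoint.

(** * Unitary equivalence of purifications *)

Section Copair.
Variable X : Type.

Definition copair m n (f : 'I_m -> X) (g : 'I_n -> X) (j : 'I_(m + n)) : X :=
  match split j with inl i => f i | inr i => g i end.

Lemma copairl m n (f : 'I_m -> X) (g : 'I_n -> X) i :
  copair f g (lshift n i) = f i.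
Proof. by rewrite /copair -[lshift n i]/(unsplit (inl i)) unsplitK. Qed.

Lemma copairr m n (f : 'I_m -> X) (g : 'I_n -> X) i :
  copair f g (rshift m i) = g i.
Proof. by rewrite /copair -[rshift m i]/(unsplit (inr i)) unsplitK. Qed.

End Copair.

Lemma big_prod (V : zmodType) (I J : finType) (F : I * J -> V) :
  \sum_p F p = \sum_i \sum_j F (i, j).
Proof. by rewrite pair_bigA; apply: eq_bigr => -[]. Qed.

Lemma big_prod_split (V : zmodType) r m n (F : 'I_r * 'I_(m + n) -> V) :
  \sum_k F k = \sum_p F (p.1, lshift n p.2) + \sum_p F (p.1, rshift m p.2).
Proof.
rewrite !big_prod /= -big_split /=.
by apply: eq_bigr => i _; rewrite big_split_ord.
Qed.

Lemma big_prod_slice (V : zmodType) r n (r0 : 'I_r) (F : 'I_r * 'I_n -> V) :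
  (forall k, k.1 != r0 -> F k = 0) -> \sum_k F k = \sum_j F (r0, j).
Proof.
move=> F0; rewrite big_prod (bigD1 r0) //=.
by rewrite [X in _ + X]big1 ?addr0 // => i ir; rewrite big1 // => j _; apply: F0.
Qed.

Lemma big_enum_rank (V : zmodType) (K : finType) (F : 'I_#|K| -> V) :
  \sum_i F i = \sum_k F (enum_rank k).
Proof. by rewrite (reindex enum_rank) //; apply/onW_bij/enum_rank_bij. Qed.

Section Purification.
Variable C : numClosedFieldType.

Lemma sum_delta (K : finType) (F : K -> C) k :
  \sum_l (if k == l then 1 else 0) * F l = F k.
Proof.
rewrite (bigD1 k) //= eqxx mul1r big1 ?addr0 // => l lk.
by rewrite eq_sym (negPf lk) mul0r.
Qed.

(* With pairwise orthogonal rows of squared norm 2, this is the orthogonal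
   reflection [1 - 2 Pi] for [Pi] the projection onto the row space. *)
Definition reflection (K : finType) n (T : 'I_n -> K -> C) (k l : K) : C :=
  (if k == l then 1 else 0) - \sum_c T c k * (T c l)^*.

(** Write the operator as [1 - G]: [G] is self-adjoint, and the hypothesis gives [G^2 = 2 G], so
    [(1 - G)^2 = 1]. *)
Lemma reflection_unitary (K : finType) n (T : 'I_n -> K -> C) :
  (forall c d, \sum_k (T c k)^* * T d k = 2 * (if c == d then 1 else 0)) ->
  forall i k, \sum_j (reflection T j i)^* * reflection T j k =
    if i == k then 1 else 0.
Proof.
move=> TT i k.
pose G i j := \sum_c T c i * (T c j)^*.
have adjE j : (reflection T j i)^* = (if i == j then 1 else 0) - G i j.
  rewrite /reflection rmorphB /= rmorph_sum eq_sym /= (fun_if Num.conj).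
  rewrite rmorph1 rmorph0.
  by congr (_ - _); apply: eq_bigr => c _; rewrite rmorphM /= conjCK mulrC.
under eq_bigr => j _ do rewrite adjE mulrBl.
rewrite sumrB sum_delta /reflection -/(G i k).
under eq_bigr => j _ do rewrite mulrBr.
rewrite sumrB.
have -> : \sum_j G i j * (if j == k then 1 else 0) = G i k.
  under eq_bigr => j _ do rewrite mulrC eq_sym.
  by rewrite sum_delta.
have -> : \sum_j G i j * (\sum_c T c j * (T c k)^*) = 2 * G i k.
  under eq_bigr => j _.
    rewrite mulr_suml.
    under eq_bigr => c _ do rewrite mulr_sumr.
    over.
  rewrite exchange_big /= mulr_sumr; apply: eq_bigr => c _.
  rewrite exchange_big /=.
  transitivity (\sum_d (if c == d then 1 else 0) * (2 * T c i * (T d k)^*)).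
    apply: eq_bigr => d _.
    transitivity (T c i * (T d k)^* * \sum_j (T c j)^* * T d j).
      by rewrite mulr_sumr; apply: eq_bigr => j _; ring.
    by rewrite TT; ring.
  by rewrite sum_delta mulrA.
by move: (G i k) (if _ then _ else _) => g e; ring.
Qed.

Lemma apply_reflection (K : finType) n (T : 'I_n -> K -> C) (v : K -> C) k :
  \sum_l reflection T k l * v l =
  v k - \sum_d T d k * \sum_l (T d l)^* * v l.
Proof.
rewrite /reflection.
under eq_bigr => j _ do rewrite mulrBl.
rewrite sumrB sum_delta; congr (_ - _).
under eq_bigr => j _ do rewrite mulr_suml.
rewrite exchange_big /=; apply: eq_bigr => d _; rewrite mulr_sumr.
by apply: eq_bigr => j _; rewrite mulrA.
Qed.

Section Frame.
Variables (n r m : nat) (r0 : 'I_r).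
Variables (V0 V1 : 'I_n -> 'I_r * 'I_m -> C) (E0 E1 : 'I_n -> 'I_n -> C).

Let J := (m + (m + (n + n)))%N.

(* The workspace has four sectors; the last two, of dimension [n], only have to
   hold the padding of [polar_padded], hence a single value [r0] of the other
   register suffices for them. *)
Definition block_frame c (k : 'I_r * 'I_J) : C :=
  copair (fun i => V0 c (k.1, i)) (copair (fun i => V1 c (k.1, i))
    (copair (fun d => if k.1 == r0 then E0 c d else 0)
            (fun d => if k.1 == r0 then E1 c d else 0))) k.2.

(** The hypothesis on [F] discards the zero entries of the padding sectors away from [r0]. *)
Lemma sum_block_frame (F : 'I_r * 'I_J -> C -> C) c : (forall k, F k 0 = 0) ->
  \sum_k F k (block_frame c k) =
    \sum_p F (p.1, lshift _ p.2) (V0 c p) +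
    \sum_p F (p.1, rshift _ (lshift _ p.2)) (V1 c p) +
    (\sum_j F (r0, rshift _ (rshift _ (lshift _ j))) (E0 c j) +
     \sum_j F (r0, rshift _ (rshift _ (rshift _ j))) (E1 c j)).
Proof.
move=> F0; rewrite !big_prod_split /= addrA; congr (_ + _ + (_ + _)).
- by apply: eq_bigr => -[i j] _; rewrite /block_frame /= copairl.
- by apply: eq_bigr => -[i j] _; rewrite /block_frame /= copairr copairl.
- rewrite (big_prod_slice (r0 := r0)); last first.
    move=> k /negPf kr.
    by rewrite /block_frame /= !(copairr, copairl) kr F0.
  by apply: eq_bigr => j _; rewrite /block_frame /= !(copairr, copairl) eqxx.
- rewrite (big_prod_slice (r0 := r0)); last first.
    move=> k /negPf kr.
    by rewrite /block_frame /= !(copairr, copairl) kr F0.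
  by apply: eq_bigr => j _; rewrite /block_frame /= !(copairr, copairl) eqxx.
Qed.

End Frame.
Local Notation zero := (fun _ _ => 0).

Lemma block_frame_gram n r m (r0 : 'I_r) (V0 V1 : 'I_n -> 'I_r * 'I_m -> C)
    (E0 E1 : 'I_n -> 'I_n -> C) W0 W1 D0 D1 c d :
  \sum_k (block_frame r0 V0 V1 E0 E1 c k)^* * block_frame r0 W0 W1 D0 D1 d k =
    \sum_p (V0 c p)^* * W0 d p + \sum_p (V1 c p)^* * W1 d p +
    (\sum_j (E0 c j)^* * D0 d j + \sum_j (E1 c j)^* * D1 d j).
Proof.
pose F k x : C := x^* * block_frame r0 W0 W1 D0 D1 d k.
rewrite (@sum_block_frame _ _ _ r0 V0 V1 E0 E1 F); last first.
  by move=> k; rewrite /F rmorph0 mul0r.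
congr (_ + _ + (_ + _)).
- by apply: eq_bigr => -[i j] _; rewrite /F /block_frame /= copairl.
- by apply: eq_bigr => -[i j] _; rewrite /F /block_frame /= copairr copairl.
- by apply: eq_bigr => j _; rewrite /F /block_frame /= !(copairr, copairl) eqxx.
- by apply: eq_bigr => j _; rewrite /F /block_frame /= !(copairr, copairl) eqxx.
Qed.

(** The reflection swapping the two frames carries [phi], which is [P0] times the first frame, to
    [P0 W], where [W] is the second frame; and [chi] is [P1 W]. The rows of [W] are orthonormal, so
    the squared error is the trace of [(P0 - P1)^2], to which [powers_stormer] applies. Equality of
    the traces cancels its subtracted term. *)
Lemma uhlmann_reflection n r m (r0 : 'I_r) (A0 A1 : 'I_n -> 'I_r * 'I_m -> C) :
  \sum_c \sum_p A0 c p * (A0 c p)^* = \sum_c \sum_p A1 c p * (A1 c p)^* ->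
  let phi := block_frame r0 A0 zero zero zero in
  let chi := block_frame r0 zero A1 zero zero in
  exists (M : 'M[C]_n) (U : 'I_r * 'I__ -> 'I_r * 'I__ -> C),
    [/\ M *m M = M, M^t* = M,
      forall i k, \sum_j (U j i)^* * U j k = if i == k then 1 else 0 &
      let delta c k := \sum_l U k l * phi c l - chi c k in
      \sum_c \sum_k (delta c k)^* * delta c k <=
      2 * \sum_c \sum_d M c d *
        \sum_p (A0 d p * (A0 c p)^* - A1 d p * (A1 c p)^*)].
Proof.
move=> trA phi chi.
pose mx (A : 'I_n -> 'I_r * 'I_m -> C) : 'M[C]_(n, _) :=
  \matrix_(c < n, k < #|{: 'I_r * 'I_m}|) A c (enum_val k).
pose fn (A : 'M[C]_(n, #|{: 'I_r * 'I_m}|)) (c : 'I_n) (p : 'I_r * 'I_m) : C :=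
  A c (enum_rank p).
have fnK A c p : fn (mx A) c p = A c p by rewrite /fn mxE enum_rankK.
have gramE (A B : 'M_(n, #|{: 'I_r * 'I_m}|)) c d :
    (A *m B^t*) c d = \sum_p fn A c p * (fn B d p)^*.
  by rewrite mxE big_enum_rank; apply: eq_bigr => p _; rewrite !mxE.
have [B0 [P0 [V0 [E0 [P0E A0E VE0 PE0]]]]] := polar_padded (mx A0).
have [B1 [P1 [V1 [E1 [P1E A1E VE1 PE1]]]]] := polar_padded (mx A1).
have [M [MM Madj ineq]] := powers_stormer P0E P1E.
have Padj0 : P0^t* = P0 by rewrite P0E adjmxM trmxCK.
have Padj1 : P1^t* = P1 by rewrite P1E adjmxM trmxCK.
have AV n' m' (A V : 'M[C]_(n', m')) (P E : 'M_n') : A = P *m V ->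
    V *m V^t* + E *m E^t* = 1%:M -> P *m E = 0 -> A *m V^t* = P.
  move=> -> VE PE; rewrite -mulmxA -[V *m _](addrK (E *m E^t*)) VE.
  by rewrite mulmxBr mulmx1 mulmxA PE mul0mx subr0.
have AA n' m' (A V : 'M[C]_(n', m')) (P E : 'M_n') : A = P *m V -> P^t* = P ->
    V *m V^t* + E *m E^t* = 1%:M -> P *m E = 0 -> A *m A^t* = P *m P.
  move=> AE Ph VE PE; rewrite {2}AE adjmxM mulmxA.
  by rewrite (AV _ _ _ _ _ _ AE VE PE) Ph.
(* [V0] and [V1] sit in different sectors, so the rows [(V0, E0)] and
   [(V1, E1)] are orthonormal and mutually orthogonal, and the reflection in
   their differences swaps them. *)
pose T := block_frame r0 (fn V0) (fun c p => - fn V1 c p) E0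
            (fun c j => - E1 c j).
pose W := block_frame r0 zero (fn V1) zero E1.
have VEsum V (E : 'M_n) c d : V *m V^t* + E *m E^t* = 1%:M ->
    \sum_p (fn V c p)^* * fn V d p + \sum_j (E c j)^* * E d j =
    if c == d then 1 else 0.
  move=> /matrixP/(_ d c); rewrite mxE gramE !mxE eq_sym mulrb => <-.
  by congr (_ + _); apply: eq_bigr => p _; rewrite ?mxE mulrC.
have TT c d : \sum_k (T c k)^* * T d k = 2 * (if c == d then 1 else 0).
  rewrite block_frame_gram addrACA VEsum //.
  under eq_bigr do rewrite rmorphN mulrNN.
  under [X in _ + (_ + X)]eq_bigr do rewrite rmorphN mulrNN.
  by rewrite VEsum // mulr_natl mulr2n.
have Tphi c d : \sum_l (T d l)^* * phi c l = P0 c d.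
  rewrite block_frame_gram.
  rewrite [X in _ + X + _]big1 => [|p _]; last by rewrite mulr0.
  rewrite [X in _ + (X + _)]big1 => [|p _]; last by rewrite mulr0.
  rewrite [X in _ + (_ + X)]big1 => [|p _]; last by rewrite mulr0.
  rewrite !addr0 -[in RHS](AV _ _ _ _ _ _ A0E VE0 PE0) gramE.
  by apply: eq_bigr => p _; rewrite fnK mulrC.
pose S := P0 - P1.
have WW c d : \sum_k (W c k)^* * W d k = if c == d then 1 else 0.
  rewrite block_frame_gram.
  rewrite [X in X + _ + _]big1 => [|p _]; last by rewrite mulr0.
  rewrite [X in _ + (X + _)]big1 => [|p _]; last by rewrite mulr0.
  by rewrite !add0r VEsum.
have PV0 c p : \sum_d P0 c d * fn V0 d p = A0 c p.
  by rewrite -[RHS]fnK A0E /fn mxE.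
have PV1 c p : \sum_d P1 c d * fn V1 d p = A1 c p.
  by rewrite -[RHS]fnK A1E /fn mxE.
have PE0s c j : \sum_d P0 c d * E0 d j = 0.
  by move/matrixP/(_ c j): PE0; rewrite !mxE.
have PE1s c j : \sum_d P1 c d * E1 d j = 0.
  by move/matrixP/(_ c j): PE1; rewrite !mxE.
exists M, (reflection T); split => //; first exact: reflection_unitary.
move=> delta.
have deltaE c k : delta c k = \sum_d S c d * W d k.
  rewrite /delta apply_reflection.
  under eq_bigr => d _ do rewrite Tphi mulrC.
  have -> : \sum_d S c d * W d k =
    \sum_d P0 c d * W d k - \sum_d P1 c d * W d k.
    by rewrite -sumrB; apply: eq_bigr => d _; rewrite !mxE mulrBl.
  (* Sector by sector: the first cancels by [P0 V0 = A0], the second uses [P1 V1 = A1], and the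
     padding sectors use [P0 E0 = 0] and [P1 E1 = 0]. *)
  rewrite /phi /chi /T /W /block_frame; case: k => i j /=.
  rewrite -[j]splitK; case: (split j) => {}j; rewrite /unsplit.
    under eq_bigr do rewrite copairl.
    under [in RHS]eq_bigr do rewrite copairl.
    under [X in _ = _ - X]eq_bigr do rewrite copairl.
    rewrite !copairl PV0 !subr0.
    by rewrite !big1 ?subr0 ?subrr // => d _; rewrite mulr0.
  rewrite !copairr.
  under eq_bigr do rewrite copairr.
  under [in RHS]eq_bigr do rewrite copairr.
  under [X in _ = _ - X]eq_bigr do rewrite copairr.
  rewrite -[j]splitK; case: (split j) => {}j; rewrite /unsplit.
    under eq_bigr do rewrite copairl mulrN.
    under [in RHS]eq_bigr do rewrite copairl.
    under [X in _ = _ - X]eq_bigr do rewrite copairl.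
    by rewrite !copairl sumrN sub0r opprK PV1.
  rewrite !copairr.
  under eq_bigr do rewrite copairr.
  under [in RHS]eq_bigr do rewrite copairr.
  under [X in _ = _ - X]eq_bigr do rewrite copairr.
  rewrite -[j]splitK; case: (split j) => {}j; rewrite /unsplit.
    under eq_bigr do rewrite copairl.
    under [in RHS]eq_bigr do rewrite copairl.
    under [X in _ = _ - X]eq_bigr do rewrite copairl.
    rewrite !copairl; case: eqP => _; rewrite ?PE0s.
      by rewrite !big1 ?subrr ?subr0 // => d _; rewrite mulr0.
    by rewrite !big1 ?subrr ?subr0 // => d _; rewrite mulr0.
  rewrite !copairr.
  under eq_bigr do rewrite copairr.
  under [in RHS]eq_bigr do rewrite copairr.
  under [X in _ = _ - X]eq_bigr do rewrite copairr.
  case: eqP => _.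
    under eq_bigr do rewrite mulrN.
    by rewrite PE1s sumrN sub0r opprK.
  by rewrite !big1 ?subrr ?subr0 // => d _; rewrite mulr0.
have -> : \sum_c \sum_k (delta c k)^* * delta c k = \tr (S *m S).
  have Sadj : S^t* = S by rewrite adjmxB Padj0 Padj1.
  rewrite -[in RHS]Sadj mxtrace_mulC {1}Sadj /mxtrace; apply: eq_bigr => c _.
  rewrite mxE.
  transitivity (\sum_d \sum_e (S c d)^* * S c e * \sum_k (W d k)^* * W e k).
    under [in RHS]eq_bigr => d _.
      under eq_bigr => e _ do rewrite mulr_sumr.
      rewrite exchange_big /=; over.
    rewrite exchange_big /=; apply: eq_bigr => k _.
    rewrite deltaE rmorph_sum mulr_suml; apply: eq_bigr => d _.
    by rewrite mulr_sumr; apply: eq_bigr => e _; rewrite rmorphM /=; ring.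
  apply: eq_bigr => d _.
  under eq_bigr => e _ do rewrite WW mulrC.
  by rewrite sum_delta !mxE mulrC.
apply: le_trans ineq _.
have trE A : \sum_c \sum_p A c p * (A c p)^* = \tr (mx A *m (mx A)^t*).
  rewrite /mxtrace; apply: eq_bigr => c _; rewrite gramE.
  by apply: eq_bigr => p _; rewrite fnK.
have G0 := AA _ _ _ _ _ _ A0E Padj0 VE0 PE0.
have G1 := AA _ _ _ _ _ _ A1E Padj1 VE1 PE1.
rewrite [X in _ - X]linearB /= -G0 -G1 -!trE trA subrr subr0.
rewrite le_eqVlt; apply/orP; left; apply/eqP; congr (_ * _).
rewrite /mxtrace; apply: eq_bigr => c _; rewrite mxE; apply: eq_bigr => d _.
congr (_ * _); rewrite !mxE.
rewrite sumrB !big_enum_rank.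
by congr (_ - _); apply: eq_bigr => p _; rewrite !mxE enum_rankK.
Qed.

End Purification.

(** * The attack for finitely many strings *)

Lemma big_prod_slices (V : zmodType) (I K L : finType) (F : I * (K * L) -> V) :
  \sum_p F p = \sum_l \sum_p F (p.1, (p.2, l)).
Proof.
rewrite big_prod.
under eq_bigr do rewrite big_prod.
by rewrite [RHS]exchange_big big_prod.
Qed.

(** * Quadratic forms on tensor products *)

Section QuadraticForms.
Variable C : numClosedFieldType.

Definition qform (K : finType) (A : K -> K -> C) (v : K -> C) : C :=
  \sum_i (v i)^* * \sum_j A i j * v j.

Lemma qform_ext (K : finType) (A B : K -> K -> C) u v :
  A =2 B -> u =1 v -> qform A u = qform B v.
Proof.
move=> AB uv; apply: eq_bigr => i _; rewrite uv; congr (_ * _).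
by apply: eq_bigr => j _; rewrite uv AB.
Qed.

Lemma qformZ (K : finType) (A : K -> K -> C) (a : C) v :
  qform A (fun i => a * v i) = `|a| ^+ 2 * qform A v.
Proof.
rewrite normCK /qform mulr_sumr; apply: eq_bigr => i _.
rewrite rmorphM /= !mulr_sumr; apply: eq_bigr => j _; ring.
Qed.

(** The difference of the two sides is the form at [u / 4 + 4 v]. The coefficient of [u] stays near
    1; the large one falls on an error that hiding makes small. *)
Lemma qform_young (K : finType) (A : K -> K -> C) u v :
  (forall w, 0 <= qform A w) ->
  qform A (fun i => u i - v i) <= 17 / 16 * qform A u + 17 * qform A v.
Proof.
move=> A0; rewrite -subr_ge0.
have -> : 17 / 16 * qform A u + 17 * qform A v - qform A (fun i => u i - v i) =
    qform A (fun i => 1 / 4 * u i + 4 * v i).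
  rewrite /qform !mulr_sumr -!(sumrB, big_split) /=; apply: eq_bigr => i _.
  rewrite !mulr_sumr -!(sumrB, big_split) /=; apply: eq_bigr => j _.
  rewrite rmorphB rmorphD !rmorphM /= fmorphV !rmorph_nat.
  by move: (u i)^* (v i)^* => x y; field.
exact: A0.
Qed.

Lemma projection_qform_ge0 n (M : 'M[C]_n) v : M *m M = M -> M^t* = M ->
  0 <= qform (fun c d => M c d) v.
Proof.
move=> MM Mh; pose x : 'rV[C]_n := \row_i (v i)^*.
have := gram_diag_ge0 (x *m M) 0; rewrite adjmxM Mh mulmxA -(mulmxA x) MM.
rewrite -mulmxA mxE; congr (_ <= _); apply: eq_bigr => i _; rewrite !mxE.
by congr (_ * _); apply: eq_bigr => j _; rewrite !mxE conjCK.
Qed.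

Lemma qform_tensorl (I K : finType) (M : I -> I -> C) v :
  qform (fun p q : I * K => M p.1 q.1 * (if p.2 == q.2 then 1 else 0)) v =
  \sum_r qform M (fun c => v (c, r)).
Proof.
rewrite /qform big_prod exchange_big; apply: eq_bigr => r _.
apply: eq_bigr => c _; rewrite big_prod /=; congr (_ * _).
apply: eq_bigr => d _.
under eq_bigr => s _ do rewrite [M c d * _]mulrC -mulrA.
by rewrite sum_delta.
Qed.

(** The inner sum is an entry of the reduced state on [I]: a measurement of that register sees only
    the partial trace. *)
Lemma qform_tensor1 (I K : finType) (M : I -> I -> C) v :
  qform (fun p q : I * K => M p.1 q.1 * (if p.2 == q.2 then 1 else 0)) v =
  \sum_c \sum_d M c d * \sum_r (v (d, r) * (v (c, r))^*).
Proof.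
rewrite qform_tensorl /qform exchange_big; apply: eq_bigr => c _ /=.
under eq_bigr do rewrite mulr_sumr.
rewrite exchange_big; apply: eq_bigr => d _ /=; rewrite mulr_sumr.
by apply: eq_bigr => r _; ring.
Qed.

Lemma qform_slices (I K L : finType) (A : I * K -> I * K -> C) v :
  qform (fun p q : I * (K * L) => A (p.1, p.2.1) (q.1, q.2.1) *
           (if p.2.2 == q.2.2 then 1 else 0)) v =
  \sum_l qform A (fun p => v (p.1, (p.2, l))).
Proof.
rewrite /qform big_prod /=.
under eq_bigr do rewrite big_prod /=.
transitivity (\sum_p \sum_l (v (p.1, (p.2, l)))^* *
   \sum_q A p q * v (q.1, (q.2, l))); last by rewrite exchange_big.
rewrite big_prod; apply: eq_bigr => i _; apply: eq_bigr => k _ /=.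
apply: eq_bigr => l _; congr (_ * _); rewrite !big_prod /=.
apply: eq_bigr => j _; rewrite big_prod; apply: eq_bigr => k' _ /=.
under eq_bigr => s _ do rewrite [A _ _ * _]mulrC -mulrA.
by rewrite sum_delta.
Qed.

Lemma apply_tensor1 (I K : finType) (U : K -> K -> C) (v : I * K -> C) c k :
  \sum_q (if c == q.1 then 1 else 0) * U k q.2 * v q =
  \sum_l U k l * v (c, l).
Proof.
rewrite big_prod /=.
under eq_bigr => i _.
  under eq_bigr => j _ do rewrite -mulrA.
  rewrite -mulr_sumr; over.
by rewrite sum_delta.
Qed.

Lemma qform0 (K : finType) (A : K -> K -> C) : qform A (fun=> 0) = 0.
Proof.
by rewrite /qform big1 // => i _; rewrite rmorph0 mul0r.
Qed.

Lemma sum_qform_block0 n r m (r0 : 'I_r) (A : 'I_n * 'I_r -> 'I_n * 'I_r -> C)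
    (V : 'I_n -> 'I_r * 'I_m -> C) :
  \sum_l qform A (fun p => block_frame r0 V (fun _ _ => 0) (fun _ _ => 0)
                             (fun _ _ => 0) p.1 (p.2, l)) =
  \sum_i qform A (fun p => V p.1 (p.2, i)).
Proof.
rewrite big_split_ord /= [X in _ + X]big1 ?addr0 => [|l _].
  by apply: eq_bigr => i _; apply: qform_ext => // p; rewrite /block_frame copairl.
rewrite -[RHS](qform0 A); apply: qform_ext => // p.
rewrite /block_frame copairr /copair /=.
by do 2!case: split => // ?; case: ifP.
Qed.

Lemma sum_qform_block1 n r m (r0 : 'I_r) (A : 'I_n * 'I_r -> 'I_n * 'I_r -> C)
    (V : 'I_n -> 'I_r * 'I_m -> C) :
  \sum_l qform A (fun p => block_frame r0 (fun _ _ => 0) V (fun _ _ => 0)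
                             (fun _ _ => 0) p.1 (p.2, l)) =
  \sum_i qform A (fun p => V p.1 (p.2, i)).
Proof.
rewrite big_split_ord /= [X in X + _]big1 ?add0r => [|l _]; last first.
  by rewrite -[RHS](qform0 A); apply: qform_ext => // p; rewrite /block_frame copairl.
rewrite big_split_ord /= [X in _ + X]big1 ?addr0 => [|l _].
  apply: eq_bigr => i _; apply: qform_ext => // p.
  by rewrite /block_frame copairr copairl.
rewrite -[RHS](qform0 A); apply: qform_ext => // p.
rewrite /block_frame !copairr /copair /=.
by case: split => // ?; case: ifP.
Qed.

End QuadraticForms.

(** * Measurement probabilities and the purification attack *)

Section Attack.
Variable R : realType.
Local Notation C := (R[i]).

Lemma expectE (K : finType) (A : K -> K -> C) v : expect A v = qform A v.
Proof. by []. Qed.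

Lemma ReD (x y : C) : complex.Re (x + y) = complex.Re x + complex.Re y.
Proof. by case: x y => ? ? []. Qed.

Lemma le_Re (x y : C) : x <= y -> complex.Re x <= complex.Re y.
Proof. by rewrite lecE => /andP[]. Qed.

Lemma Re_sum (K : finType) (F : K -> C) :
  complex.Re (\sum_k F k) = \sum_k complex.Re (F k).
Proof. exact: (big_morph (@complex.Re R) ReD). Qed.

Lemma prob_opE (K : finType) (A : K -> K -> C) v : psd A ->
  (prob_op A v)%:C%C = expect A v.
Proof. by move=> /(_ v) Av; rewrite /prob_op RRe_real // ger0_real. Qed.

Lemma prob_op_ge0 (K : finType) (A : K -> K -> C) v : psd A ->
  0 <= prob_op A v.
Proof. by move=> Apsd; rewrite -ler0c prob_opE. Qed.

Lemma qform_id (K : finType) (v : K -> C) :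
  qform (fun i j => if i == j then 1 else 0) v = \sum_i (v i)^* * v i.
Proof. by apply: eq_bigr => i _; rewrite sum_delta. Qed.

Lemma povm_expect_le (K : finType) (A : K -> K -> C) v : povm_elem A ->
  expect A v <= braket v v.
Proof.
case=> _ /(_ v) h; rewrite -subr_ge0; move: h; congr (_ <= _).
have -> : braket v v = qform (fun i j => if i == j then 1 else 0) v.
  by rewrite qform_id.
rewrite expectE /qform -sumrB; apply: eq_bigr => i _.
by rewrite -mulrBr -sumrB; congr (_ * _); apply: eq_bigr => j _; rewrite mulrBl.
Qed.

Lemma prob_op_le1 (K : finType) (A : K -> K -> C) v : povm_elem A ->
  unit_vector v -> prob_op A v <= 1.
Proof.
move=> Apovm v1; have [Apsd _] := Apovm.
by have := povm_expect_le v Apovm; rewrite v1 -prob_opE // lecR.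
Qed.

(** Convertible with [lam_ext], but over arbitrary finite registers instead of those of a scheme. *)
Definition ext_op (I K L : finType) (A : I * K -> I * K -> C)
    (p q : I * (K * L)) : C :=
  A (p.1, p.2.1) (q.1, q.2.1) * idop L p.2.2 q.2.2.

Lemma expect_ext (I K L : finType) (A : I * K -> I * K -> C) v :
  expect (@ext_op I K L A) v = \sum_l expect A (fun p => v (p.1, (p.2, l))).
Proof. exact: qform_slices. Qed.

Lemma psd_ext (I K L : finType) (A : I * K -> I * K -> C) :
  psd A -> psd (@ext_op I K L A).
Proof. by move=> Apsd v; rewrite expect_ext sumr_ge0. Qed.

Lemma braket_slices (I K L : finType) (v : I * (K * L) -> C) :
  braket v v = \sum_l braket (fun p => v (p.1, (p.2, l)))
                             (fun p => v (p.1, (p.2, l))).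
Proof. exact: big_prod_slices. Qed.

Lemma povm_tensor1 (I K : finType) (M : I -> I -> C) :
  povm_elem M -> povm_elem (tensor M (idop K)).
Proof.
have psd_tensor (N : I -> I -> C) : psd N -> psd (tensor N (idop K)).
  move=> Npsd v; have -> : expect (tensor N (idop K)) v =
      \sum_r expect N (fun c => v (c, r)) by apply: qform_tensorl.
  exact: sumr_ge0.
case=> /psd_tensor M0 /psd_tensor M1; split=> // v.
have := M1 v; congr (_ <= _); apply: qform_ext => // -[i k] [j l].
rewrite /tensor /= mulrBl; congr (_ - _).
by rewrite /idop xpair_eqE; case: eqP => _ /=; rewrite ?mul1r ?mul0r.
Qed.

Lemma povm_ext (I K L : finType) (A : I * K -> I * K -> C) :
  povm_elem A -> povm_elem (@ext_op I K L A).
Proof.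
case=> A0 A1; split=> [|v]; first exact: psd_ext.
have := psd_ext A1 (v : I * (K * L) -> C); congr (_ <= _).
apply: qform_ext => // -[i [k l]] [j [k' l']].
rewrite /ext_op /= mulrBl; congr (_ - _).
rewrite /idop !xpair_eqE.
case: (i == j); case: (k == k'); case: (l == l') => //=;
  by rewrite ?mul1r ?mul0r ?mulr0.
Qed.

Lemma prob_op_le_norm (K : finType) (A : K -> K -> C) v : povm_elem A ->
  prob_op A v <= complex.Re (braket v v).
Proof. by move=> Apovm; apply/le_Re/povm_expect_le. Qed.

Lemma unitary_idop (K : finType) : unitary (@idop R K).
Proof.
apply: boolp.funext => i; apply: boolp.funext => k; rewrite /compose /adjoint.
under eq_bigr => j _.
  have -> : conjc (idop K j i : C) = if i == j then 1 else 0.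
    by rewrite /idop eq_sym; case: eqP => _; rewrite ?conjc1 ?conjc0.
  over.
exact: sum_delta.
Qed.

Lemma apply_op_tensor_idop (I K : finType) (v : I * K -> C) :
  apply_op (tensor (idop I) (idop K)) v = v.
Proof.
apply: boolp.funext => -[c k].
have -> : apply_op (tensor (idop I) (idop K)) v (c, k) =
    \sum_l idop K k l * v (c, l) by apply: apply_tensor1.
exact: sum_delta.
Qed.

Lemma purification_attack n r m (w : 'I_m -> R)
    (Psi : 'I_m -> bool -> 'I_n * 'I_r -> C) :
  (forall i, 0 <= w i) -> \sum_i w i = 1 ->
  (forall i b, unit_vector (Psi i b)) ->
  exists (M : 'I_n -> 'I_n -> C) (J : nat) (phi : 'I_n * ('I_r * 'I_J) -> C)
         (U : 'I_r * 'I_J -> 'I_r * 'I_J -> C),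
    let psi := apply_op (tensor (idop 'I_n) U) phi in
    let tau := \sum_i w i * (prob_op (tensor M (idop 'I_r)) (Psi i false) -
                             prob_op (tensor M (idop 'I_r)) (Psi i true)) in
    [/\ povm_elem M, unit_vector phi, unitary U,
      forall A, prob_op (@ext_op _ _ _ A) phi =
        \sum_i w i * prob_op A (Psi i false) &
      forall A, povm_elem A ->
        \sum_i w i * prob_op A (Psi i true) <=
        17 / 16 * prob_op (@ext_op _ _ _ A) psi + 34 * tau].
Proof.
move=> w0 w1 Psi1.
have [i0 _|m0] := pickP 'I_m; last first.
  by move: w1; rewrite big_pred0 // => /eqP; rewrite eq_sym oner_eq0.
(* [block_frame] needs a basis value [r0]; it exists because a unit vector cannot live in dimension
   0. *)
have [r0 _|r0] := pickP 'I_r; last first.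
  have := Psi1 i0 true; rewrite /unit_vector /braket big1 => [/eqP|[? k]].
    by rewrite eq_sym oner_eq0.
  by have := r0 k.
pose s i : C := (Num.sqrt (w i))%:C%C.
have s2 i : `|s i| ^+ 2 = (w i)%:C%C.
  by rewrite normc_def /= expr0n addr0 sqrtr_sqr ger0_norm ?sqrtr_ge0 //
    -rmorphXn /= sqr_sqrtr.
(* The purification as a matrix with rows indexed by the register sent at commit time, the shape
   expected by [uhlmann_reflection]. *)
pose a b c (p : 'I_r * 'I_m) : C := s p.2 * Psi p.2 b (c, p.1).
have sJ i : s i * (s i)^* = (w i)%:C%C by rewrite -normCK s2.
have gramE b c d : \sum_p a b d p * (a b c p)^* =
    \sum_i (w i)%:C%C * \sum_k (Psi i b (d, k) * (Psi i b (c, k))^*).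
  rewrite big_prod exchange_big; apply: eq_bigr => i _; rewrite mulr_sumr.
  by apply: eq_bigr => k _; rewrite /a /= rmorphM mulrACA sJ.
have sliceE b i (A : 'I_n * 'I_r -> 'I_n * 'I_r -> C) :
    qform A (fun p => a b p.1 (p.2, i)) = (w i)%:C%C * qform A (Psi i b).
  by rewrite -s2 -qformZ; apply: qform_ext => // -[].
have wC1 : \sum_i (w i)%:C%C = 1 :> C.
  by rewrite -(rmorph_sum (real_complex R)) w1.
have [|M [U [MM Mh UU]]] := @uhlmann_reflection _ n r m r0 (a false) (a true).
  have tr1 b : \sum_c \sum_p a b c p * (a b c p)^* = 1.
    under eq_bigr do rewrite gramE.
    rewrite exchange_big -[RHS]wC1; apply: eq_bigr => i _.
    rewrite -mulr_sumr -[RHS]mulr1; congr (_ * _).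
    rewrite -[RHS](Psi1 i b) /braket big_prod; apply: eq_bigr => c _.
    by apply: eq_bigr => k _; rewrite mulrC.
  by rewrite !tr1.
set phi := block_frame r0 (a false) _ _ _.
set chi := block_frame r0 _ (a true) _ _.
move=> /= ineq.
pose phi' p := phi p.1 p.2.
pose psi := apply_op (tensor (idop 'I_n) U) phi'.
pose chi' p := chi p.1 p.2.
pose delta p := psi p - chi' p.
have psiE c k : psi (c, k) = \sum_l U k l * phi c l by apply: apply_tensor1.
exists (fun c d => M c d), _, phi', U => /=.
have psd_proj (N : 'M[C]_n) : N *m N = N -> N^t* = N -> psd (fun c d => N c d).
  by move=> NN Nh v; apply: projection_qform_ge0.
have reC (q : R) (x : C) : complex.Re (q%:C%C * x) = q * complex.Re x.
  by case: x => x y /=; rewrite mul0r subr0.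
split.
- split; first exact: psd_proj.
  move=> v; have := @psd_proj (1%:M - M) _ _ v.
  rewrite mulmxBl !mulmxBr !mulmx1 mul1mx MM subrr subr0 adjmxB adjmx1 Mh.
  move=> /(_ erefl erefl); congr (_ <= _); apply: qform_ext => // i j.
  by rewrite !mxE /idop mulrb.
- rewrite /unit_vector braket_slices.
  under eq_bigr => l _.
    rewrite -[braket _ _](qform_id (fun p : 'I_n * 'I_r => phi' (p.1, (p.2, l)))).
    over.
  rewrite sum_qform_block0 -[RHS]wC1; apply: eq_bigr => i _.
  rewrite sliceE qform_id -[RHS]mulr1; congr (_ * _).
  exact: Psi1.
- apply: boolp.funext => i; apply: boolp.funext => k; exact: UU.
- move=> A; rewrite /prob_op expect_ext.
  transitivity (complex.Re (\sum_i (w i)%:C%C * qform A (Psi i false))).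
    congr complex.Re; under [RHS]eq_bigr do rewrite -sliceE.
    by rewrite -(sum_qform_block0 r0 A (a false)).
  by rewrite Re_sum; apply: eq_bigr => i _; rewrite reC.
move=> A Apovm; have [Apsd _] := Apovm.
(* The trace of [M] against the difference of the mean reduced states; its real part is [tau]. *)
pose X : C := \sum_c \sum_d M c d *
  \sum_p (a false d p * (a false c p)^* - a true d p * (a true c p)^*).
have XE : complex.Re X = \sum_i w i *
   (prob_op (tensor (fun c d => M c d) (idop 'I_r)) (Psi i false) -
    prob_op (tensor (fun c d => M c d) (idop 'I_r)) (Psi i true)).
  have TE b : complex.Re (\sum_c \sum_d M c d * \sum_p (a b d p * (a b c p)^*)) =
      \sum_i w i * prob_op (tensor (fun c d => M c d) (idop 'I_r)) (Psi i b).
    transitivity (complex.Re (\sum_i (w i)%:C%C *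
        qform (tensor (fun c d => M c d) (idop 'I_r)) (Psi i b))).
      congr complex.Re.
      under [RHS]eq_bigr do rewrite qform_tensor1 mulr_sumr.
      rewrite [RHS]exchange_big; apply: eq_bigr => c _ /=.
      under [RHS]eq_bigr do rewrite mulr_sumr.
      rewrite [RHS]exchange_big; apply: eq_bigr => d _ /=.
      rewrite gramE mulr_sumr; apply: eq_bigr => i _.
      by rewrite mulrCA.
    by rewrite Re_sum; apply: eq_bigr => i _; rewrite reC.
  under [RHS]eq_bigr do rewrite mulrBr.
  rewrite sumrB -!TE /X.
  under eq_bigr => c _.
    under eq_bigr do rewrite sumrB mulrBr.
    rewrite sumrB; over.
  by rewrite sumrB; case: (\sum_c _) (\sum_c _) => ? ? [].
have key : \sum_i (w i)%:C%C * qform A (Psi i true) <=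
    (17 / 16)%:C%C * expect (@ext_op _ _ _ A) psi + 34%:C%C * X.
  have -> : (17 / 16)%:C%C = 17 / 16 :> C.
    rewrite (rmorphM (real_complex R)) (fmorphV (real_complex R)).
    by rewrite !(rmorph_nat (real_complex R)).
  rewrite (rmorph_nat (real_complex R)).
  have -> : \sum_i (w i)%:C%C * qform A (Psi i true) =
      \sum_l qform A (fun p => chi' (p.1, (p.2, l))).
    under eq_bigr do rewrite -sliceE.
    by rewrite -(sum_qform_block1 r0 A (a true)).
  (* Here [chi' = psi - delta], slice by slice. *)
  have step l : qform A (fun p => chi' (p.1, (p.2, l))) <=
      17 / 16 * qform A (fun p => psi (p.1, (p.2, l))) +
      17 * qform A (fun p => delta (p.1, (p.2, l))).
    apply: le_trans (qform_young _ _ Apsd).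
    rewrite le_eqVlt; apply/orP; left; apply/eqP; apply: qform_ext => // p.
    by rewrite /delta opprB addrC subrK.
  have dle : \sum_l qform A (fun p => delta (p.1, (p.2, l))) <= 2 * X.
    apply: le_trans ineq; rewrite -[X in _ <= X]/(\sum_c \sum_k _).
    have -> : \sum_c \sum_k (\sum_l U k l * phi c l - chi c k)^* *
        (\sum_l U k l * phi c l - chi c k) = braket delta delta.
      rewrite /braket big_prod; apply: eq_bigr => c _; apply: eq_bigr => k _.
      by rewrite /delta psiE.
    rewrite braket_slices; apply: ler_sum => l _; exact: povm_expect_le.
  rewrite expect_ext.
  apply: le_trans (ler_sum _ (fun l _ => step l)) _.
  rewrite big_split /= -!mulr_sumr lerD2l.
  have -> : 34 * X = 17 * (2 * X) by ring.
  by rewrite ler_pM2l.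
have ReL : complex.Re (\sum_i (w i)%:C%C * qform A (Psi i true)) =
    \sum_i w i * prob_op A (Psi i true).
  by rewrite Re_sum; apply: eq_bigr => i _; rewrite reC.
by rewrite -XE -ReL; have := le_Re key; rewrite ReD !reC.
Qed.

End Attack.

(** * Discrete distributions *)

Section Distributions.
Variable R : realType.

Lemma ler_sum_uniq_sub (T : eqType) (a : T -> R) s s' :
  (forall t, 0 <= a t) -> uniq s -> uniq s' -> {subset s <= s'} ->
  \sum_(t <- s) a t <= \sum_(t <- s') a t.
Proof.
move=> a0 us us' ss'; rewrite [leRHS](bigID (mem s)) /= -[X in X + _]big_filter.
rewrite [X in X + _](perm_big s) /=; last first.
  apply: uniq_perm => // [|t]; first exact: filter_uniq.
  by rewrite mem_filter /=; case: (boolP (t \in s)) => //= /ss' ->.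
by rewrite lerDl sumr_ge0.
Qed.

Lemma fin_sum_le_esum (T : choiceType) (a : T -> R) s : uniq s ->
  ((\sum_(t <- s) a t)%:E <= \esum_(t in [set: T]) (a t)%:E)%E.
Proof.
move=> us; apply: esum_ge; exists [set` s]%classic.
  by split=> //; apply: finite_seq.
by rewrite -fsbig_seq //= sumEFin.
Qed.

Lemma esum_le_bound (T : choiceType) (a : T -> R) B :
  (forall s, uniq s -> \sum_(t <- s) a t <= B) ->
  (\esum_(t in [set: T]) (a t)%:E <= B%:E)%E.
Proof.
move=> aB; apply: ge_ereal_sup => _ [X [finX _] <-].
by rewrite fsbig_finite //= sumEFin lee_fin aB.
Qed.

Lemma distr_finite_sum_le1 (T : choiceType) (p : T -> R) s :
  is_distr p -> uniq s -> \sum_(t <- s) p t <= 1.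
Proof. by case=> _ p1 us; rewrite -lee_fin -p1 fin_sum_le_esum. Qed.

Lemma distr_finite_mass (T : choiceType) (p : T -> R) eta :
  is_distr p -> 0 < eta -> exists2 s, uniq s & 1 - eta <= \sum_(t <- s) p t.
Proof.
case=> _ p1 eta0.
have : ((1 - eta)%:E < \esum_(t in [set: T]) (p t)%:E)%E.
  by rewrite p1 lte_fin; lra.
move=> /ereal_sup_gt[_ [X [finX _] <-]].
rewrite fsbig_finite //= sumEFin lte_fin => /ltW le; exists (fset_set X) => //.
Qed.

Section Expectation.
Variables (T : choiceType) (p : T -> R) (f : T -> R) (B : R).
Hypotheses (p_distr : is_distr p) (f_ge0 : forall t, 0 <= f t).
Hypothesis f_le : forall t, f t <= B.

(** [fine] sends infinity to 0, so finiteness is what makes [expectation] the true mean. *)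
Lemma eexpect_fin_num : eexpect p f \is a fin_num.
Proof.
have [p0 _] := p_distr.
rewrite ge0_fin_numE; last by apply: esum_ge0 => t _; rewrite lee_fin mulr_ge0.
(* The maximum with 0 is a nonnegative bound obtained without naming a point of [T]. *)
apply: le_lt_trans (ltry (Num.max 0 B)); apply: esum_le_bound => s us.
apply: (@le_trans _ _ (\sum_(t <- s) p t * Num.max 0 B)).
  by apply: ler_sum => t _; rewrite ler_wpM2l // le_max f_le orbT.
rewrite -mulr_suml ler_piMl ?distr_finite_sum_le1 //.
by rewrite le_max lexx.
Qed.

Lemma fin_sum_le_expectation s : uniq s ->
  \sum_(t <- s) p t * f t <= expectation p f.
Proof.
move=> us; rewrite -lee_fin /expectation fineK ?eexpect_fin_num //.
exact: fin_sum_le_esum.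
Qed.

End Expectation.

(** Apply the lower bound by partial sums to [1 - f]. *)
Lemma expectation_le_fin_sum (T : choiceType) (p f : T -> R) s :
  is_distr p -> (forall t, 0 <= f t) -> (forall t, f t <= 1) -> uniq s ->
  expectation p f <= \sum_(t <- s) p t * f t + (1 - \sum_(t <- s) p t).
Proof.
move=> pd f0 f1 us; have [p0 p1] := pd.
have g0 t : 0 <= 1 - f t by rewrite subr_ge0.
have g1 t : 1 - f t <= 1 by rewrite gerBl.
have sum1 : expectation p f + expectation p (fun t => 1 - f t) = 1.
  apply: EFin_inj; rewrite EFinD /expectation.
  rewrite !fineK ?(@eexpect_fin_num _ _ _ 1) // /eexpect.
  rewrite -esumD => [|t _|t _]; try by rewrite lee_fin mulr_ge0.
  rewrite -[RHS]p1; apply: eq_esum => t _; rewrite -EFinD; congr _%:E; ring.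
have := fin_sum_le_expectation pd g0 g1 us.
under eq_bigr do rewrite mulrBr mulr1.
rewrite sumrB; lra.
Qed.

(* Truncating to finite sets of strings, the product of the marginals of [D]
   is within [3 eps] of [D]: replace one marginal at a time by [E] and [F]. *)
Lemma near_product_marginals (X Y : choiceType) (D : X * Y -> R) (E : X -> R)
    (F : Y -> R) (eps eta : R) :
  is_distr D -> is_distr E -> is_distr F ->
  (l1_dist_prod D E F <= eps%:E)%E -> 0 < eta ->
  exists xs ys, [/\ uniq xs, uniq ys,
    1 - eta <= \sum_(x <- xs) \sum_(y <- ys) D (x, y) &
    \sum_(x <- xs) \sum_(y <- ys)
      `|(\sum_(y' <- ys) D (x, y')) * (\sum_(x' <- xs) D (x', y)) - D (x, y)|
      <= 3 * eps + 2 * eta].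
Proof.
move=> Dd Ed Fd l1 eta0.
have [G uG mG] := distr_finite_mass Dd eta0.
have [X0 uX0 mX0] := distr_finite_mass Ed eta0.
have [Y0 uY0 mY0] := distr_finite_mass Fd eta0.
(* The rectangle contains [G] and its sides contain [X0] and [Y0], so [D], [E] and [F] each lose
   mass at most [eta]. *)
pose xs := undup (map fst G ++ X0); pose ys := undup (map snd G ++ Y0).
have uxs : uniq xs by apply: undup_uniq.
have uys : uniq ys by apply: undup_uniq.
have uxy : uniq [seq (x, y) | x <- xs, y <- ys].
  by rewrite allpairs_uniq // => -[a b] [c d].
have [D0 _] := Dd; have [E0 _] := Ed; have [F0 _] := Fd.
have mD : 1 - eta <= \sum_(x <- xs) \sum_(y <- ys) D (x, y).
  rewrite -big_allpairs; apply: le_trans mG _; apply: ler_sum_uniq_sub => //.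
  move=> [x y] xyG; apply/allpairsP; exists (x, y); split=> //.
    by rewrite mem_undup mem_cat (map_f fst xyG).
  by rewrite mem_undup mem_cat (map_f snd xyG).
have mE : 1 - eta <= \sum_(x <- xs) E x.
  apply: le_trans mX0 _; apply: ler_sum_uniq_sub => // x xX.
  by rewrite mem_undup mem_cat xX orbT.
have mF : 1 - eta <= \sum_(y <- ys) F y.
  apply: le_trans mY0 _; apply: ler_sum_uniq_sub => // x xX.
  by rewrite mem_undup mem_cat xX orbT.
have dist : \sum_(x <- xs) \sum_(y <- ys) `|D (x, y) - E x * F y| <= eps.
  rewrite -lee_fin; apply: le_trans l1.
  by rewrite -(big_allpairs (F := fun p => `|D p - E p.1 * F p.2|)) fin_sum_le_esum.
have E1 := distr_finite_sum_le1 Ed uxs.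
have F1 := distr_finite_sum_le1 Fd uys.
have D1 : \sum_(x <- xs) \sum_(y <- ys) D (x, y) <= 1.
  by rewrite -big_allpairs distr_finite_sum_le1.
exists xs, ys; split=> //.
pose DX x := \sum_(y <- ys) D (x, y); pose DY y := \sum_(x <- xs) D (x, y).
have marg_X : \sum_(x <- xs) `|DX x - E x| <= eps + eta.
  apply: (@le_trans _ _ (\sum_(x <- xs)
      (\sum_(y <- ys) `|D (x, y) - E x * F y| + E x * eta))).
    apply: ler_sum => x _.
    have -> : DX x - E x = \sum_(y <- ys) (D (x, y) - E x * F y)
        - E x * (1 - \sum_(y <- ys) F y).
      by rewrite sumrB -mulr_sumr /DX; ring.
    apply: le_trans (ler_normB _ _) _; rewrite lerD ?ler_norm_sum //.
    rewrite ger0_norm; first by rewrite ler_wpM2l //; lra.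
    by rewrite mulr_ge0 // subr_ge0.
  by rewrite big_split /= -mulr_suml lerD // ler_piMl // ltW.
have marg_Y : \sum_(y <- ys) `|DY y - F y| <= eps + eta.
  apply: (@le_trans _ _ (\sum_(y <- ys)
      (\sum_(x <- xs) `|D (x, y) - E x * F y| + F y * eta))).
    apply: ler_sum => y _.
    have -> : DY y - F y = \sum_(x <- xs) (D (x, y) - E x * F y)
        - F y * (1 - \sum_(x <- xs) E x).
      by rewrite sumrB -mulr_suml /DY; ring.
    apply: le_trans (ler_normB _ _) _; rewrite lerD ?ler_norm_sum //.
    rewrite ger0_norm; first by rewrite ler_wpM2l //; lra.
    by rewrite mulr_ge0 // subr_ge0.
  rewrite big_split /= -mulr_suml exchange_big /=.
  by rewrite lerD // ler_piMl // ltW.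
have DX0 x : 0 <= DX x by apply: sumr_ge0.
apply: (@le_trans _ _ (\sum_(x <- xs) \sum_(y <- ys)
   (DX x * `|DY y - F y| + `|DX x - E x| * F y + `|D (x, y) - E x * F y|))).
  apply: ler_sum => x _; apply: ler_sum => y _.
  rewrite -/(DX x) -/(DY y).
  (* Replace [DY] by [F], then [DX] by [E]. Summed, the three differences cost [eps + eta],
     [eps + eta] and [eps]. *)
  have -> : DX x * DY y - D (x, y) =
    DX x * (DY y - F y) + (DX x - E x) * F y - (D (x, y) - E x * F y) by ring.
  apply: le_trans (ler_normB _ _) _; rewrite lerD2r.
  apply: le_trans (ler_normD _ _) _.
  by rewrite !normrM (ger0_norm (DX0 x)) (ger0_norm (F0 y)).
under eq_bigr do rewrite !big_split /= -mulr_sumr -mulr_sumr.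
rewrite !big_split /= -!mulr_suml.
have := marg_X; have := marg_Y.
set a := \sum_(y <- ys) _; set b := \sum_(x <- xs) `|_|; set c := \sum_(x <- xs) DX x.
have a0 : 0 <= a by apply: sumr_ge0.
have b0 : 0 <= b by apply: sumr_ge0.
have c0 : 0 <= c by apply: sumr_ge0.
have ca : c * a <= a by rewrite ler_piMl.
have bF : b * (\sum_(y <- ys) F y) <= b by rewrite ler_piMr.
lra.
Qed.

(** Exponent 1 suffices: once [n > k], the factor [n] dominates [k.+1]. *)
Lemma negligible_small (f : nat -> R) k : negligible f ->
  exists N : nat, forall n : nat, (N <= n)%N -> `|f n| * k.+1%:R < 1.
Proof.
move=> /(_ 1%N)[N fN]; exists (maxn N k.+1) => n; rewrite geq_max => /andP[Nn kn].
apply: le_lt_trans (fN n Nn); rewrite expr1 ler_wpM2l //.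
by rewrite ler_nat.
Qed.

End Distributions.

(** * Breaking the scheme *)

Record attack (R : realType) (c r : nat) := Attack {
  distinguisher : 'I_c -> 'I_c -> R[i];
  workspace : nat;
  commit_state : 'I_c * ('I_r * 'I_workspace) -> R[i];
  opening : bool -> 'I_r * 'I_workspace -> 'I_r * 'I_workspace -> R[i] }.
Arguments commit_state {R c r}.
Arguments opening {R c r}.

(** This treats one security parameter. The small advantage is a premise of the last clause because
    hiding is asymptotic: it can be invoked only once distinguishers are fixed for all
    parameters. *)
Lemma attack_exists (R : realType) (X Y : choiceType) (c r : nat)
    (Psi : X -> bool -> 'I_c * 'I_r -> R[i])
    (Lam : Y -> bool -> 'I_c * 'I_r -> 'I_c * 'I_r -> R[i])
    (D : X * Y -> R) (E : X -> R) (F : Y -> R) (eps : R) :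
  (forall x b, unit_vector (Psi x b)) -> (forall y b, povm_elem (Lam y b)) ->
  is_distr D -> is_distr E -> is_distr F ->
  (l1_dist_prod D E F <= eps%:E)%E -> eps <= 13 / 100 ->
  (forall b,
    eexpect D (fun xy => prob_op (Lam xy.2 b) (Psi xy.1 b)) = 1%E) ->
  exists a : attack R c r,
    [/\ povm_elem (distinguisher a), unit_vector (commit_state a),
      forall b, unitary (opening a b) &
      let out b := expectation D (fun xy =>
        prob_op (tensor (distinguisher a) (idop 'I_r)) (Psi xy.1 b)) in
      let acc b := expectation D (fun xy => prob_op (ext_op (Lam xy.2 b))
        (apply_op (tensor (idop 'I_c) (opening a b)) (commit_state a))) in
      out false - out true <= 1 / 1000 -> 11 / 10 <= acc false + acc true].
Proof.
move=> Psi1 Lam1 Dd Ed Fd l1 eps_le corr.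
have [|xs [ys [uxs uys mD near]]] :=
  @near_product_marginals _ _ _ _ _ _ _ (1 / 1000) Dd Ed Fd l1.
  lra.
have [D0 _] := Dd.
have uxy : uniq [seq (x, y) | x <- xs, y <- ys].
  by rewrite allpairs_uniq // => -[? ?] [].
pose DX x := \sum_(y <- ys) D (x, y); pose DY y := \sum_(x <- xs) D (x, y).
pose Z := \sum_(x <- xs) DX x.
have ZE : \sum_(y <- ys) DY y = Z by rewrite exchange_big.
have Z0 : 0 < Z by rewrite /Z /DX; lra.
have Z1 : Z <= 1 by rewrite /Z -big_allpairs distr_finite_sum_le1.
have DX0 x : 0 <= DX x by apply: sumr_ge0.
have DY0 x : 0 <= DY x by apply: sumr_ge0.
have [x0 _] : exists x0 : X, True.
  move: Z0; rewrite /Z; case: (xs) => [|x ?]; last by exists x.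
  by rewrite big_nil ltxx.
pose pt (i : 'I_(size xs)) := nth x0 xs i.
(* The truncated marginal has mass [Z], so it is rescaled to a distribution. *)
pose w i := Z^-1 * DX (pt i).
have sumw (G : X -> R) : \sum_i w i * G (pt i) =
    Z^-1 * \sum_(x <- xs) DX x * G x.
  rewrite (big_nth x0) big_mkord mulr_sumr.
  by apply: eq_bigr => i _; rewrite mulrA.
have w0 i : 0 <= w i by rewrite mulr_ge0 // invr_ge0 ltW.
have w1 : \sum_i w i = 1.
  have := sumw (fun=> 1); under eq_bigr do rewrite mulr1.
  under [X in _ * X]eq_bigr do rewrite mulr1.
  by rewrite -/Z mulVf // gt_eqF.
have [M [J [phi [U [Mp phi1 Uu acc0 acc1]]]]] :=
  purification_attack w0 w1 (fun i b => Psi1 (pt i) b).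
(* Opening to 0 applies the identity; only the bit 1 requires [U]. *)
exists (@Attack R c r M J phi (fun b => if b then U else idop _)); split => //=.
  by case=> //; apply: unitary_idop.
rewrite apply_op_tensor_idop.
set psi := apply_op _ phi in acc1 *.
set out0 := expectation D (fun _ => prob_op (tensor M _) _).
set out1 := expectation D (fun _ => prob_op (tensor M _) _) => adv.
pose f b x y := prob_op (Lam y b) (Psi x b).
pose t b x := prob_op (tensor M (idop 'I_r)) (Psi x b).
have Mp' := povm_tensor1 'I_r Mp.
have f0 b x y : 0 <= f b x y by apply: prob_op_ge0; case: (Lam1 y b).
have f1 b x y : f b x y <= 1 by apply: prob_op_le1.
have t0 b x : 0 <= t b x by apply: prob_op_ge0; case: Mp'.
have t1 b x : t b x <= 1 by apply: prob_op_le1.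
(* [607 / 1000 = 1 - 3 * (13 / 100) - 3 * (1 / 1000)] *)
have honest b : 607 / 1000 <=
    \sum_(x <- xs) \sum_(y <- ys) DX x * DY y * f b x y.
  have := @expectation_le_fin_sum _ _ D (fun xy => f b xy.1 xy.2) _ Dd
    (fun xy => f0 b _ _) (fun xy => f1 b _ _) uxy.
  rewrite /expectation corr /= !big_allpairs /= -/Z => h.
  (* Since [f] lies between 0 and 1, passing to the product of marginals costs at most the distance
     bounded by [near]. *)
  have : \sum_(x <- xs) \sum_(y <- ys) D (x, y) * f b x y <=
    \sum_(x <- xs) \sum_(y <- ys) DX x * DY y * f b x y +
    \sum_(x <- xs) \sum_(y <- ys) `|DX x * DY y - D (x, y)|.
    rewrite -big_split; apply: ler_sum => x _ /=.
    rewrite -big_split; apply: ler_sum => y _ /=.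
    rewrite -lerBlDl -mulrBl.
    apply: (@le_trans _ _ (`|DX x * DY y - D (x, y)| * f b x y)).
      by rewrite ler_wpM2r // -normrN opprB ler_norm.
    by rewrite ler_piMr.
  move: near mD; rewrite -/Z; lra.
have swap (G : X -> Y -> R) : \sum_(x <- xs) \sum_(y <- ys) DX x * DY y * G x y =
    \sum_(y <- ys) DY y * \sum_(x <- xs) DX x * G x y.
  rewrite exchange_big; apply: eq_bigr => y _; rewrite mulr_sumr.
  by apply: eq_bigr => x _; rewrite mulrCA mulrA.
(* The attack state does not depend on [x], so summing [D] over [xs] leaves [DY]. *)
have accE b v : \sum_(y <- ys) DY y * prob_op (ext_op (Lam y b)) v <=
    expectation D (fun xy => prob_op (@ext_op _ _ _ 'I_J (Lam xy.2 b)) v).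
  apply: le_trans (fin_sum_le_expectation (B := complex.Re (braket v v)) Dd
    _ _ uxy).
  - rewrite big_allpairs exchange_big /= le_eqVlt; apply/orP; left; apply/eqP.
    by apply: eq_bigr => y _; rewrite mulr_suml.
  - by move=> xy; apply: prob_op_ge0; case: (povm_ext 'I_J (Lam1 xy.2 b)).
  - by move=> xy; apply: prob_op_le_norm; apply: povm_ext.
(* As [Z <= 1], rescaling can only raise the acceptance probability. *)
have inflate b y : \sum_(x <- xs) DX x * f b x y <= \sum_i w i * f b (pt i) y.
  rewrite (sumw (fun x => f b x y)) ler_peMl ?invf_ge1 //.
  by apply: sumr_ge0 => x _; rewrite mulr_ge0.
have p0 : 607 / 1000 <= expectation D (fun xy =>
    prob_op (@ext_op _ _ _ 'I_J (Lam xy.2 false)) phi).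
  apply: le_trans (accE false phi); apply: le_trans (honest false) _.
  rewrite swap; apply: ler_sum => y _; rewrite ler_wpM2l //.
  by rewrite acc0; apply: inflate.
pose tau := \sum_(i < size xs) w i * (t false (pt i) - t true (pt i)).
(* The factor [Z] undoes the rescaling; one thousandth is the advantage, the other the mass lost by
   truncation. *)
have tau_le : Z * tau <= 2 / 1000.
  rewrite /tau (sumw (fun x => t false x - t true x)) mulVKf ?gt_eqF //.
  have h0 := @fin_sum_le_expectation _ _ D (fun xy => t false xy.1) 1 Dd
    (fun xy => t0 _ _) (fun xy => t1 _ _) _ uxy.
  have h1 := @expectation_le_fin_sum _ _ D (fun xy => t true xy.1) _ Dd
    (fun xy => t0 _ _) (fun xy => t1 _ _) uxy.
  have tE b : \sum_(x <- xs) \sum_(y <- ys) D (x, y) * t b x =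
      \sum_(x <- xs) DX x * t b x.
    by apply: eq_bigr => x _; rewrite mulr_suml.
  move: h0 h1; rewrite !big_allpairs /= !tE -/Z -/out0 -/out1.
  under [X in _ -> _ -> X <= _]eq_bigr do rewrite mulrBr.
  rewrite sumrB; move: adv mD; rewrite -/Z; lra.
have p1 : 607 / 1000 <= 17 / 16 * expectation D (fun xy =>
    prob_op (@ext_op _ _ _ 'I_J (Lam xy.2 true)) psi) + 34 * (Z * tau).
  apply: le_trans (honest true) _; rewrite swap.
  apply: (@le_trans _ _ (\sum_(y <- ys) DY y *
      (17 / 16 * prob_op (@ext_op _ _ _ 'I_J (Lam y true)) psi + 34 * tau))).
    apply: ler_sum => y _; rewrite ler_wpM2l //.
    by apply: le_trans (inflate true y) _; apply: acc1.
  under eq_bigr do rewrite mulrDr mulrCA.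
  rewrite big_split /= -mulr_sumr -mulr_suml ZE [Z * (_ * _)]mulrCA lerD2r.
  by rewrite ler_wpM2l.
(* By [p1] and [tau_le], the bit 1 is accepted with probability at least 16/17 of
   [(607 - 68) / 1000], above [507 / 1000]; adding [607 / 1000] for the bit 0 exceeds [11 / 10]. *)
lra.
Qed.

Theorem theoremA8 (R : realType)
  (D : nat -> seq bool * seq bool -> R)
  (E F : nat -> seq bool -> R) :
  (forall n, is_distr (D n)) ->
  (forall n, is_distr (E n)) ->
  (forall n, is_distr (F n)) ->
  (forall n, (l1_dist_prod (D n) (E n) (F n) < ((5 - 2 * Num.sqrt 2) / 17)%:E)%E) ->
  ~ exists S : scheme R,
      [/\ well_formed S, correct D S, stat_hiding D S & stat_sum_binding D S].
Proof.
move=> Dd Ed Fd near [S [[Psi1 Lam1] corr hiding binding]].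
have eps_le : (5 - 2 * Num.sqrt 2) / 17 <= 13 / 100 :> R.
  (* Bounding the root below by [14 / 10] leaves [11 / 85], just under [13 / 100]. *)
  have : (14 / 10 : R) <= Num.sqrt 2.
    have -> : 14 / 10 = Num.sqrt ((14 / 10) ^+ 2) :> R.
      by rewrite sqrtr_sqr ger0_norm //; lra.
    by apply: ler_wsqrtr; lra.
  by move=> ?; lra.
have H n := attack_exists (Psi1 n) (Lam1 n) (Dd n) (Ed n) (Fd n)
  (ltW (near n)) eps_le (corr n).
(* One attack is chosen per parameter before hiding and binding are invoked. *)
pose a n := sval (cid (H n)).
have [N1 adv_small] := negligible_small 1000 (hiding
  (fun n _ => distinguisher (a n))
  (fun n _ => let: And4 p _ _ _ := svalP (cid (H n)) in p)).
have [||nu [/(negligible_small 10)[N2 nu_small] acc_le]] := binding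
  (fun n => workspace (a n)) (fun n _ => commit_state (a n))
  (fun n b _ => opening (a n) b).
- by move=> n _; have [] := svalP (cid (H n)).
- by move=> n b _; have [_ _ Uu _] := svalP (cid (H n)).
(* Past both thresholds the advantage is below [1 / 1000] and [nu n] below [1 / 10], so the
   acceptance sum would be both at least and below [11 / 10]. *)
pose n := maxn N1 N2.
have := adv_small n (leq_maxl _ _); set adv := `|_| => adv_n.
have := nu_small n (leq_maxr _ _) => nu_n.
have nu_lt : nu n < 1 / 10 by have := ler_norm (nu n); move: nu_n; lra.
have adv_le : adv <= 1 / 1000 by move: adv_n; lra.
have [_ _ _ /(_ (le_trans (ler_norm _) adv_le)) acc_ge] := svalP (cid (H n)).
have := le_trans acc_ge (acc_le n); lra.
Qed.
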